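(* Let $\theta>\aleph_0$ be a cardinal, let $n,r<\omega$, and let $\lambda$ be an infinite cardinal with $\lambda=\lambda^{<\theta}$. Then $$(\lambda^+)^{r}\times n\rightarrow(\theta\times n,\ \theta\times r)^2_2 .$$
   Context: Work in ZFC. Here $(\lambda^+)^r$ is ordinal exponentiation, and $\alpha\times\beta$ is the ordinal product ($\beta$ consecutive copies of $\alpha$). For cardinals, $\lambda^{<\theta}=\sup_{\nu<\theta}\lambda^\nu$ ($\nu$ ranging over cardinals). For ordinals $\gamma,\alpha,\beta$, $\gamma\rightarrow(\alpha,\beta)^2_2$ means: for every $c:[\gamma]^2\to\{\text{red},\text{green}\}$ (where $[\gamma]^2$ is the set of two-element subsets of $\gamma$), either there is $A\subseteq\gamma$ of order type $\alpha$ such that $c$ is constantly red on $[A]^2$, or there is $B\subseteq\gamma$ of order type $\beta$ such that $c$ is constantly green on $[B]^2$. *)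

(* Defs.v *)
(* MathComp, with the classical layer of MathComp-Analysis for sets and
   cardinality. *)
From HB Require Import structures.
From mathcomp Require Import all_boot all_order.
From mathcomp Require Import finmap.
From mathcomp Require Import boolp classical_sets functions cardinality.
From mathcomp Require wochoice.

Set Implicit Arguments.
Unset Strict Implicit.
Unset Printing Implicit Defensive.

Local Open Scope order_scope.
Local Open Scope classical_set_scope.
Local Open Scope card_scope.

(* Ordinals are represented, up to isomorphism, by well-ordered types: a totally
   ordered type T such that [well_ordered T]. Displays (d, d', ...) only select
   notations and carry no mathematical content. *)
Definition well_ordered d (T : orderType d) : Prop :=
  wochoice.well_order (<=%O : rel T).

Definition card_lt T U (A : set T) (B : set U) : Prop :=
  A #<= B /\ ~ (B #<= A).

(* Cardinals are initial ordinals: no proper initial segment is equipotent to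
   the whole. *)
Definition is_cardinal d (K : orderType d) : Prop :=
  well_ordered K /\ forall x : K, card_lt [set y : K | y < x] [set: K].

Definition is_succ_cardinal d (L : orderType d) d' (K : orderType d') : Prop :=
  [/\ is_cardinal K, card_lt [set: L] [set: K]
    & forall d'' (M : orderType d''), is_cardinal M ->
        card_lt [set: L] [set: M] -> [set: K] #<= [set: M]].

(* |K| bounds L ^ N for all cardinals N < Theta, where L ^ N is the cardinality
   of the set of all functions N -> L. *)
Definition bounds_powers_below d (L : orderType d) d' (Theta : orderType d')
    d'' (K : orderType d'') : Prop :=
  forall e (N : orderType e), is_cardinal N ->
    card_lt [set: N] [set: Theta] -> [set: N -> L] #<= [set: K].

(* K = L ^ {< Theta}, a supremum in the class of cardinals. *)
Definition is_power_below d (L : orderType d) d' (Theta : orderType d')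
    d'' (K : orderType d'') : Prop :=
  [/\ is_cardinal K, bounds_powers_below L Theta K
    & forall e (M : orderType e), is_cardinal M ->
        bounds_powers_below L Theta M -> [set: K] #<= [set: M]].

(* The ordinal product A x B is B consecutive copies of A. In [B *lexi A] the
   B-component is the most significant one. *)
Definition ord_mul dA (A : orderType dA) dB (B : orderType dB) :
    orderType Order.OrdinalOrder.ord_display :=
  (B *lexi[Order.OrdinalOrder.ord_display] A)%type.

(* Ordinal exponentiation with a finite exponent:
   A ^ 0 = 1 and A ^ (r + 1) = A ^ r x A. *)
Fixpoint ord_exp d (A : orderType d) (r : nat) : orderType Order.OrdinalOrder.ord_display :=
  if r is r'.+1 then ord_mul (ord_exp A r') A else 'I_1.

Inductive color : Set := red | green.

(* [T]^2, the set of two-element subsets of T. *)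
Definition pairs (T : choiceType) : Type := {e : {fset T} | #|` e| == 2}.

Definition constant_on (T : choiceType) (c : pairs T -> color) (k : color)
    (A : set T) : Prop :=
  forall e : pairs T, [set` val e] `<=` A -> c e = k.

Definition has_order_type d (G : orderType d) (A : set G)
    d' (X : orderType d') : Prop :=
  exists f : X -> G, {mono f : x y / x <= y} /\ range f = A.

(* G -> (X, Y)^2_2 *)
Definition arrows d (G : orderType d) d1 (X : orderType d1)
    d2 (Y : orderType d2) : Prop :=
  forall c : pairs G -> color,
    (exists A : set G, has_order_type A X /\ constant_on c red A) \/
    (exists B : set G, has_order_type B Y /\ constant_on c green B).

(* Main.v *)
Require Import Defs.
From HB Require Import structures.
From mathcomp Require Import all_boot all_order.
From mathcomp Require Import finmap.
From mathcomp Require Import boolp classical_sets functions cardinality.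
From mathcomp Require wochoice.

Set Implicit Arguments.
Unset Strict Implicit.
Unset Printing Implicit Defensive.

Import Order.TTheory.

Local Open Scope order_scope.
Local Open Scope classical_set_scope.
Local Open Scope card_scope.

(* Call a set small if it has at most Lambda elements, and call a subset of
   Lambda'^r positive if it is positive for the r-fold Fubini power of the ideal
   of small sets; this ideal is complete under small unions. We induct on r:
   take n consecutive copies V_i of Lambda'^(r+1) containing neither a red set
   of type Theta x n nor a green one of type Theta x (r+1).
   - By Erdos-Rado every positive set contains a green set of size Theta.
   - If B is green of size Theta, no positive set D is joined to B in green:
     otherwise n rows of D, to which the induction hypothesis applies, would
     contain r green blocks, and B would be one more.
   - If every positive subset of some V_k contained a red B of size Theta joined
     in red to a positive D, iterating inside D would give n red blocks. So we
     may shrink the V_i to exclude this.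
   Under these conditions there are X_i of size Theta in the V_i whose union is
   red, which gives the contradiction. Take a small M closed under choosing
   green sets of size Theta in the positive sets definable from fewer than Theta
   points of M, and suitably generic points d_i of V_i over M; then build the X_i
   inside M in Theta steps by reflecting the d_i. *)

(** * Cardinalities and well-orders *)

Lemma card_le_inj T U (A : set T) (B : set U) (f : T -> U) :
  (forall x, A x -> B (f x)) ->
  (forall x y, A x -> A y -> f x = f y -> x = y) -> A #<= B.
Proof.
move=> fAB fI; have /card_eqPle[_ AfA] : f @` A #= A.
  by apply: inj_card_eq => x y; rewrite !inE; apply: fI.
by apply: card_le_trans AfA _; apply: subset_card_le => _ [x Ax <-]; apply: fAB.
Qed.

Lemma card_le_sub_image T U (A : set T) (B : set U) (g : U -> T) :
  A `<=` g @` B -> A #<= B.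
Proof. by move/subset_card_le/card_le_trans; apply; apply: card_image_le. Qed.

Lemma card_leE T U (A : set T) (B : set U) :
  A #<= B -> A !=set0 -> exists g : U -> T, A = g @` B.
Proof. by move=> /pfcard_geP[->[//]|/surjfunPex]. Qed.

Lemma card_le_injE T U (A : set T) (B : set U) (u : U) : A #<= B ->
  exists f : T -> U, (forall x, A x -> B (f x)) /\
    (forall x y, A x -> A y -> f x = f y -> x = y).
Proof.
have [-> _|A0 AB] := eqVneq A set0; first by exists (fun=> u).
have [g Ag] := card_leE AB ((set0P _).1 A0).
have fP x : exists y, A x -> B y /\ g y = x.
  have [Ax|nAx] := pselect (A x); last by exists u.
  by move: (Ax); rewrite Ag => -[y By <-]; exists y.
have [f fE] := choice fP; exists f; split=> [x /fE[]//|x y Ax Ay fxy].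
by have [_ <-] := fE x Ax; have [_ <-] := fE y Ay; rewrite fxy.
Qed.

Lemma card_le_setX T T' U U' (A : set T) (A' : set T') (B : set U) (B' : set U') :
  A #<= B -> A' #<= B' -> A `*` A' #<= B `*` B'.
Proof.
move=> AB AB'; have [->//|/set0P[[a a'] [/= Aa Aa']]] := eqVneq (A `*` A') set0.
have [|g Ag] := card_leE AB; first by exists a.
have [|g' Ag'] := card_leE AB'; first by exists a'.
apply: (@card_le_sub_image _ _ _ _ (fun u => (g u.1, g' u.2))) => -[x x'] /=.
by rewrite Ag Ag' => -[/= [y By <-] [y' By' <-]]; exists (y, y').
Qed.

Section WellOrder.
Context d (T : orderType d) (wo : well_ordered T).

Definition segment (t : T) : set T := [set s | s < t].

Lemma well_ordered_min (A : set T) :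
  A !=set0 -> exists2 z, A z & forall x, A x -> z <= x.
Proof.
move=> [x Ax]; have [|z [[]]] := wo (A := mem A).
  by exists x; rewrite inE.
by rewrite inE => Az zle _; exists z => // y Ay; apply: zle; rewrite inE.
Qed.

Lemma well_ordered_wf : well_founded (fun x y : T => x < y).
Proof.
move=> x; apply: contrapT => nx.
have [|z nz zmin] := @well_ordered_min [set y | ~ Acc (fun x y : T => x < y) y].
  by exists x.
apply: nz; constructor => y yz; apply: contrapT => /zmin.
by rewrite leNgt yz.
Qed.

End WellOrder.

(** Well-founded recursion with a choice at each step. The condition on a new value sees only the
    set of earlier values, which is no larger than the set of predecessors; [z0] is a default that
    induction rules out on [D]. *)
Lemma transfinite_choice_set T (lt : T -> T -> Prop) (D : set T) Z (z0 : Z)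
    (C : set Z) (Q : set Z -> Z -> Prop) :
  well_founded lt ->
  (forall t (X : set Z), D t -> X `<=` C -> X #<= [set s | D s /\ lt s t] ->
     exists2 z, C z & Q X z) ->
  exists f : T -> Z, forall t, D t ->
    C (f t) /\ Q (f @` [set s | D s /\ lt s t]) (f t).
Proof.
move=> wf H.
pose good t (g : forall s, lt s t -> Z) z :=
  C z /\ Q [set y | exists s (h : lt s t), D s /\ g s h = y] z.
pose F t (g : forall s, lt s t -> Z) : Z :=
  if pselect (exists z, good t g z) is left h then projT1 (cid h) else z0.
pose f := Fix wf (fun=> Z) F.
have fE t : f t = F t (fun s _ => f s).
  apply: Fix_eq => x g g' gg'; congr F.
  by apply: functional_extensionality_dep => s; apply: funext.
exists f; elim/(well_founded_ind wf) => t IH Dt.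
have imE : [set y | exists s (h : lt s t), D s /\ f s = y] =
    f @` [set s | D s /\ lt s t].
  apply/seteqP; split=> [_ [s [st [Ds <-]]]|_ [s [Ds st] <-]]; first by exists s.
  by exists s, st.
rewrite fE /F; case: pselect => [h|[]].
  by case: cid => z [Cz zP] /=; split=> //; rewrite -imE.
have [||z Cz zP] := H t (f @` [set s | D s /\ lt s t]) Dt.
- by move=> _ [s [Ds st] <-]; have [] := IH s st Ds.
- exact: card_image_le.
by exists z; split=> //; rewrite imE.
Qed.

Lemma transfinite_choice T (lt : T -> T -> Prop) (D : set T) Z (z0 : Z)
    (C : set Z) (rho : Z -> Z -> Prop) :
  well_founded lt ->
  (forall t (X : set Z), D t -> X `<=` C -> X #<= [set s | D s /\ lt s t] ->
     exists2 z, C z & forall x, X x -> rho z x) ->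
  exists f : T -> Z, forall t, D t ->
    C (f t) /\ forall s, D s -> lt s t -> rho (f t) (f s).
Proof.
move=> wf /(transfinite_choice_set z0 wf)[f fP]; exists f => t Dt.
have [Cf Qf] := fP t Dt; split=> // s Ds st.
by apply: Qf; exists s.
Qed.

(** Greedy injection: the values taken before [t] cannot exhaust [Y], so a fresh one remains. Below,
    this serves as the comparability of cardinals. *)
Lemma card_le_greedy T (lt : T -> T -> Prop) (D : set T) U (Y : set U) :
  well_founded lt -> (forall s t, s = t \/ lt s t \/ lt t s) ->
  (forall t, D t -> ~ (Y #<= [set s | D s /\ lt s t])) -> D #<= Y.
Proof.
move=> wf tri H; have [->//|/set0P[t0 Dt0]] := eqVneq D set0.
have [Y0|/set0P[y0 _]] := eqVneq Y set0.
  by case: (H t0 Dt0); rewrite Y0.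
have [t X Dt XY Xt|f fP] :=
  @transfinite_choice T lt D U y0 Y (fun z x => z <> x) wf.
  apply: contrapT => nex; apply: (H t Dt); apply: card_le_trans Xt.
  apply: subset_card_le => y Yy; apply: contrapT => nXy; apply: nex.
  by exists y => // x Xx yx; rewrite yx in nXy.
apply: (@card_le_inj _ _ _ _ f) => [t /fP[]//|s t Ds Dt fst].
case: (tri s t) => [//|[st|ts]].
  by case: (fP t Dt) => _ /(_ s Ds st); rewrite fst.
by case: (fP s Ds) => _ /(_ t Dt ts); rewrite fst.
Qed.

Section WellOrderCard.
Context d (T : orderType d) (wo : well_ordered T).

Let lexb (x y : T * bool) : Prop :=
  x.1 < y.1 \/ x.1 = y.1 /\ (~~ x.2 && y.2).

Let lexb_wf : well_founded lexb.
Proof.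
case=> t; elim/(well_founded_ind (well_ordered_wf wo)): t => t IH.
have f : Acc lexb (t, false).
  by constructor=> -[s b] [/= st|/= []]; [exact: IH|rewrite andbF].
case; last exact: f.
constructor=> -[s b] [/= st|/= [-> ]]; first exact: IH.
by case: b => // _; exact: f.
Qed.

Let lexb_tri x y : x = y \/ lexb x y \/ lexb y x.
Proof.
case: x y => [x b] [y c]; rewrite /lexb /=.
case: (ltgtP x y) => [||->]; [by right; left; left|by right; right; left|].
by case: b c => -[]; [left|right; right; right|right; left; right|left].
Qed.

Lemma card_le_double (D : set T) :
  (forall u, D u -> ~ (D #<= [set v | v <= u] `*` [set: bool])) ->
  D `*` [set: bool] #<= D.
Proof.
move=> H; apply: (card_le_greedy lexb_wf lexb_tri) => -[u b] [/= Du _] le.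
apply: (H u Du); apply: card_le_trans le _; apply: subset_card_le.
move=> [v c] [[/= Dv _]]; rewrite /lexb /= => -[|[-> _]]; split=> //=.
exact: ltW.
Qed.

Lemma card_le_segmentS (u : T) : infinite_set (segment u) ->
  [set v | v <= u] #<= segment u `*` [set: bool].
Proof.
move=> /infinite_setN0[z zu].
apply: (@card_le_inj _ _ _ _ (fun v => if v == u then (z, true) else (v, false))).
  move=> v /=; rewrite le_eqVlt; case: eqP => //= _ vu.
by move=> v w _ _; case: eqP => [->|_]; case: eqP => [->|_] // [].
Qed.

(** This is $\kappa\cdot 2=\kappa$, by induction on [t]. Either an earlier segment is as large, or
    the greedy injection works: an embedding of [segment t] into two copies of the points up to [u]
    would, by induction at [u], squeeze it into [segment u]. *)
Lemma card_le_segment_double (t : T) :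
  infinite_set (segment t) -> segment t `*` [set: bool] #<= segment t.
Proof.
elim/(well_founded_ind (well_ordered_wf wo)): t => t IH inft.
have [[u ut tu]|nex] := pselect (exists2 u, u < t & segment t #<= segment u).
  have ut' : segment u #<= segment t.
    by apply: subset_card_le => x /= /lt_trans; apply.
  have infu : infinite_set (segment u) by move=> /(card_le_finite tu).
  apply: card_le_trans ut'; apply: card_le_trans (IH u ut infu).
  exact: card_le_setX.
apply: card_le_double => u ut le.
have [fin|inf] := pselect (finite_set [set v | v <= u]).
  by apply: inft; apply: card_le_finite le _; apply: finite_setX.
have infu : infinite_set (segment u).
  move=> fin; apply: inf; apply: (@sub_finite_set _ _ (segment u `|` [set u])).
    by move=> v /=; rewrite le_eqVlt => /orP[/eqP|]; [right|left].
  by rewrite finite_setU.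
apply: nex; exists u => //; apply: card_le_trans le _.
apply: card_le_trans (IH u ut infu).
apply: card_le_setX => //; apply: card_le_trans (IH u ut infu).
exact: card_le_segmentS.
Qed.

End WellOrderCard.

(** * Sets smaller than a given cardinal *)

Section Cardinal.
Context d (K : orderType d) (Kcard : is_cardinal K).
Let wo : well_ordered K := Kcard.1.

(** By comparability this negative form means $|X|<|K|$; [card_ltK_ex] recovers a bound by a proper
    initial segment. *)
Definition card_ltK U (X : set U) := ~ ([set: K] #<= X).

Lemma card_ltK_le U V (X : set U) (Y : set V) :
  X #<= Y -> card_ltK Y -> card_ltK X.
Proof. by move=> XY nY /card_le_trans/(_ XY). Qed.

Lemma card_ltK_sub U (X Y : set U) : X `<=` Y -> card_ltK Y -> card_ltK X.
Proof. by move/subset_card_le; apply: card_ltK_le. Qed.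

Lemma card_ltK_segment (t : K) : card_ltK (segment t).
Proof. by have [_] := Kcard.2 t. Qed.

Lemma lt_tricho (s t : K) : s = t \/ s < t \/ t < s.
Proof.
by case: (ltgtP s t) => [||->]; [right; left|right; right|left].
Qed.

Lemma card_ltK_ex U (X : set U) : card_ltK X -> exists t : K, X #<= segment t.
Proof.
move=> ltX; apply: contrapT => nex; apply: ltX.
apply: (card_le_greedy (well_ordered_wf wo) lt_tricho) => t _ le.
apply: nex; exists t; apply: card_le_trans le _.
by apply: subset_card_le => s [].
Qed.

Hypothesis Kinf : infinite_set [set: K].

Lemma card_ltK_double (t : K) : card_ltK (segment t `*` [set: bool]).
Proof.
have [fin|inf] := pselect (finite_set (segment t)).
  by move=> le; apply: Kinf; apply: card_le_finite le _; apply: finite_setX.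
exact: card_ltK_le (card_le_segment_double wo inf) (card_ltK_segment (t := t)).
Qed.

Lemma card_ltKU U (X Y : set U) :
  card_ltK X -> card_ltK Y -> card_ltK (X `|` Y).
Proof.
move=> /card_ltK_ex[s Xs] /card_ltK_ex[t Yt].
have [u [su tu]] : exists u, segment s `<=` segment u /\ segment t `<=` segment u.
  case: (leP s t) => [st|/ltW ts].
    by exists t; split=> // x /= /lt_le_trans; apply.
  by exists s; split=> // x /= /lt_le_trans; apply.
apply: card_ltK_le (card_ltK_double (t := u)).
move: Xs => /card_le_trans/(_ (subset_card_le su)) Xu.
move: Yt => /card_le_trans/(_ (subset_card_le tu)) Yu.
have [u0|/set0P[z _]] := eqVneq (segment u) set0.
  by move: Xu Yu; rewrite u0 => /card_le0P -> /card_le0P ->; rewrite setU0.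
have [f [fX fI]] := card_le_injE z Xu; have [g [gX gI]] := card_le_injE z Yu.
apply: (@card_le_inj _ _ _ _
  (fun x => if `[< X x >] then (f x, false) else (g x, true))).
  by move=> x; case: asboolP => [/fX|nX [//|/gX]].
move=> x y xXY yXY; do 2![case: asboolP => ?] => // -[]; first exact: fI.
by case: xXY yXY => [//|?] [//|?]; apply: gI.
Qed.

Lemma card_ltK_finite U (X : set U) : finite_set X -> card_ltK X.
Proof. by move=> fX le; apply: Kinf; apply: card_le_finite fX. Qed.

Lemma card_ltK_bigcup U n (X : 'I_n -> set U) :
  (forall i, card_ltK (X i)) -> card_ltK [set x | exists i, X i x].
Proof.
elim: n X => [|n IH] X ltX.
  by apply: card_ltK_sub (card_ltK_finite (finite_set0 U)) => x [[]].
have := card_ltKU (IH (fun i => X (lift ord0 i)) (fun i => ltX _)) (ltX ord0).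
apply: card_ltK_sub => x [i Xi]; case: (unliftP ord0 i) Xi => [j ->|->].
  by left; exists j.
by right.
Qed.

Lemma card_ltK_segmentS (t : K) : card_ltK [set s | s <= t].
Proof.
apply: card_ltK_sub (card_ltKU (card_ltK_segment (t := t))
  (card_ltK_finite (finite_set1 t))) => s /=.
by rewrite le_eqVlt => /orP[/eqP|]; [right|left].
Qed.

Lemma card_leK_double : [set: K] `*` [set: bool] #<= [set: K].
Proof.
apply: card_le_double => // u _ le;
  have /card_ltK_ex[t tu] := card_ltK_segmentS (t := u).
apply: (@card_ltK_double t); apply: card_le_trans le _.
exact: card_le_setX.
Qed.

Lemma card_leK_muln n : [set: K * 'I_n] #<= [set: K].
Proof.
elim: n => [|n IH].
  by rewrite (_ : [set: _] = set0) //; apply/seteqP; split=> // -[? []].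
have [t0 _] := infinite_setN0 Kinf.
have [f [_ fI]] := card_le_injE t0 IH.
apply: card_le_trans card_leK_double.
apply: (@card_le_inj _ _ _ _ (fun x => if unlift ord0 x.2 is Some j
   then (f (x.1, j), false) else (x.1, true))) => // -[x i] [y j] _ _ /=.
case: (unliftP ord0 i) => [i' ->|->]; case: (unliftP ord0 j) => [j' ->|->] //.
  by move=> [e]; have [-> ->] := fI _ _ I I e.
by move=> [->].
Qed.

End Cardinal.

Definition initial_segment d (T : orderType d) (t : T) := {x : T | x < t}.

HB.instance Definition _ d (T : orderType d) (t : T) :=
  SubChoice.on (initial_segment t).
HB.instance Definition _ d (T : orderType d) (t : T) :=
  [SubChoice_isSubOrder of initial_segment t by <: with d].

Lemma exists_cardinal d (T : orderType d) (t : T) : well_ordered T ->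
  exists d' (M : orderType d'), is_cardinal M /\ [set: M] #= segment t.
Proof.
move=> wo; have [|u /card_eqPle[ut tu] umin] :=
  @well_ordered_min _ _ wo [set u | segment u #= segment t].
  by exists t; apply: card_eqxx.
have uE : segment u #<= [set: initial_segment u].
  by apply: (@card_le_sub_image _ _ _ _ val) => x xu; exists (exist _ x xu).
have Eu : [set: initial_segment u] #<= segment u.
  apply: (@card_le_inj _ _ _ _ val) => [[]//|x y _ _].
  exact: val_inj.
exists d, (initial_segment u); split; last first.
  by apply/card_eqPle; split; [exact: card_le_trans Eu ut|exact: card_le_trans tu uE].
split.
  apply: wochoice.antisymmetric_well_order; first exact: le_anti.
  move=> A [x Ax]; have [|z [y [Ay <-]] zmin] :=
    @well_ordered_min _ _ wo (val @` [set` A]).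
    by exists (val x), x.
  exists y; split=> // w Aw; rewrite leEsub; apply: zmin.
  by exists w.
move=> s; split; first exact: card_leT.
have su : val s < u by case: s.
move=> us; have := su; rewrite ltNge => /negP[]; apply: umin => /=.
apply/card_eqPle; split.
  apply: card_le_trans ut; by apply: subset_card_le => x /= /lt_trans/(_ su).
apply: (card_le_trans tu); apply: (card_le_trans uE); apply: (card_le_trans us).
apply: (@card_le_inj _ _ _ _ val) => [x|x y _ _]; last exact: val_inj.
by rewrite /= ltEsub.
Qed.

Lemma well_orderedP d (T : orderType d) :
  (forall A : set T, A !=set0 -> exists2 z, A z & forall x, A x -> z <= x) ->
  well_ordered T.
Proof.
move=> H; apply: wochoice.antisymmetric_well_order; first exact: le_anti.
move=> A [x Ax]; have [|z Az zmin] := H [set` A]; first by exists x.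
by exists z; split.
Qed.

Lemma ord_mul_ltE dA (A : orderType dA) dB (B : orderType dB) (x y : ord_mul A B) :
  (x < y) = (x.1 < y.1) || (x.1 == y.1) && (x.2 < y.2).
Proof. by rewrite ltEprodlexi; case: (ltgtP x.1 y.1). Qed.

Lemma well_ordered_mul dA (A : orderType dA) dB (B : orderType dB) :
  well_ordered A -> well_ordered B -> well_ordered (ord_mul A B).
Proof.
move=> woA woB; apply: well_orderedP => S [x Sx].
have [|b [a Sba] bmin] := well_ordered_min woB (A := [set b | exists a, S (b, a)]).
  by exists x.1, x.2; rewrite -surjective_pairing.
have [|a' Sba' amin] := well_ordered_min woA (A := [set a | S (b, a)]);
  first by exists a.
exists (b, a') => // -[b2 a2] S2; rewrite leNgt ord_mul_ltE /= negb_or -leNgt.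
rewrite bmin; last by exists a2.
by apply/negP => /andP[/eqP e]; rewrite e in S2; rewrite ltNge amin.
Qed.

Lemma ex_increasing d (T : orderType d) (A : set T) : A !=set0 ->
  (forall x, A x -> exists2 y, A y & x < y) ->
  exists a : nat -> T, (forall i, A (a i)) /\ forall i j, (i < j)%N -> a i < a j.
Proof.
move=> [x0 Ax0] H.
have gP x : exists y, A x -> A y /\ x < y.
  have [/H[y Ay xy]|nA] := pselect (A x); first by exists y.
  by exists x.
have [g gE] := choice gP; pose a i := iter i g x0.
have Aa i : A (a i) by elim: i => // i /gE[].
exists a; split=> // i; elim=> // j IH; rewrite ltnS leq_eqVlt.
have aj : a j < a j.+1 by have [] := gE _ (Aa j).
by move=> /predU1P[->//|/IH/lt_trans]; apply.
Qed.

Lemma well_ordered_ord n : well_ordered 'I_n.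
Proof.
apply: well_orderedP => A [x Ax].
have Ax' : `[< A x >] by apply/asboolP.
have [y /asboolP Ay ymin] :=
  @arg_minnP _ x (fun i => `[< A i >]) (fun i : 'I_n => i : nat) Ax'.
by exists y => // z Az; rewrite leEord; apply/ymin/asboolP.
Qed.

Lemma is_cardinal_ord2 : is_cardinal 'I_2.
Proof.
split; first exact: well_ordered_ord.
move=> x; split; first exact: card_leT.
move=> /(card_le_injE x)[f [fx fI]].
have f0 i : f i = ord0.
  apply/val_inj => /=; have := fx i I; rewrite /= ltEord => /leq_trans.
  by move=> /(_ _ (ltn_ord x : (x <= 1)%N)); case: (f i) => -[].
by have := fI ord0 ord_max I I; rewrite !f0 => /(_ erefl).
Qed.

(** The stages of a transfinite closure under [F]. An inductive predicate replaces recursion on [L];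
    both parameter sets must lie in one and the same earlier stage. *)
Inductive stage (d : Order.disp_t) (L : orderType d) U
    (F : set U -> set U -> set U) : L -> U -> Prop :=
| stage_lt a b x : b < a -> stage F b x -> stage F a x
| stage_op a b X Y x : b < a -> X `<=` stage F b -> Y `<=` stage F b ->
    F X Y x -> stage F a x.

(** * Cardinal arithmetic from $\lambda^{<\theta}=\lambda$ *)

Section CardinalArithmetic.
Context (dT : Order.disp_t) (Theta : orderType dT).
Context (dL : Order.disp_t) (Lambda : orderType dL).
Context (dL' : Order.disp_t) (Lambda' : orderType dL').
Hypothesis Theta_card : is_cardinal Theta.
Hypothesis Theta_gt_aleph0 : card_lt [set: nat] [set: Theta].
Hypothesis Lambda_card : is_cardinal Lambda.
Hypothesis Lambda_infinite : infinite_set [set: Lambda].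
Hypothesis Lambda_power : bounds_powers_below Lambda Theta Lambda.
Hypothesis Lambda'_succ : is_succ_cardinal Lambda Lambda'.

Local Notation small A := (A #<= [set: Lambda]).
Local Notation lt_Theta := (card_ltK Theta).

Lemma Theta_infinite : infinite_set [set: Theta].
Proof. by apply/infiniteP; case: Theta_gt_aleph0. Qed.

Lemma small_sub U (A B : set U) : A `<=` B -> small B -> small A.
Proof. by move/subset_card_le/card_le_trans; apply. Qed.

Lemma small_image U V (f : U -> V) (A : set U) : small A -> small (f @` A).
Proof. exact/card_le_trans/card_image_le. Qed.

(** Pairs are functions on a two-element cardinal, and $2<\theta$. *)
Lemma small_square : small [set: Lambda * Lambda].
Proof.
have : small [set: 'I_2 -> Lambda].
  apply: Lambda_power; first exact: is_cardinal_ord2.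
  have fin2 : finite_set [set: 'I_2] by exact: finite_finset.
  split; last by move=> /card_le_finite/(_ fin2)/Theta_infinite.
  apply: card_le_trans Theta_gt_aleph0.1.
  by apply: (@card_le_inj _ _ _ _ (fun i : 'I_2 => i : nat)) => // x y _ _ /val_inj.
apply: card_le_trans.
apply: (@card_le_sub_image _ _ _ _ (fun f : 'I_2 -> Lambda => (f ord0, f ord_max))).
by move=> -[a b] _; exists (fun i => if i == ord0 then a else b).
Qed.

Lemma small_setX U V (A : set U) (B : set V) : small A -> small B -> small (A `*` B).
Proof.
move=> sA sB; apply: card_le_trans small_square.
by rewrite -setXTT; apply: card_le_setX.
Qed.

Lemma small_bigcup I U (J : set I) (F : I -> set U) :
  small J -> (forall i, J i -> small (F i)) -> small [set x | exists2 i, J i & F i x].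
Proof.
move=> sJ sF; set B := (X in X #<= _).
have [->//|/set0P[u0 _]] := eqVneq B set0.
have pP i : exists p : Lambda -> U, J i -> F i !=set0 -> F i = range p.
  have [[/sF Fi F0]|nJ] := pselect (J i /\ F i !=set0).
    by have [p pE] := card_leE Fi F0; exists p.
  by exists (fun=> u0) => Ji F0; case: nJ.
have [p pE] := choice pP.
apply: card_le_trans (small_setX sJ (card_lexx [set: Lambda])).
apply: (@card_le_sub_image _ _ _ _ (fun x => p x.1 x.2)) => x [i Ji Fx].
by move: (Fx); rewrite pE//; [move=> [l _ <-]; exists (i, l)|exists x].
Qed.

Lemma small_finite U (A : set U) : finite_set A -> small A.
Proof.
move=> /finite_set_leP[n An]; apply: card_le_trans An _.
apply: card_le_trans ((infiniteP [set: Lambda]).1 Lambda_infinite); exact: card_leT.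
Qed.

Lemma small_setU U (A B : set U) : small A -> small B -> small (A `|` B).
Proof.
move=> sA sB; pose F (b : bool) := if b then A else B.
apply: small_sub (@small_bigcup _ _ [set: bool] F _ _).
- by move=> x [Ax|Bx]; [exists true|exists false].
- by apply: small_finite; exact: finite_finset.
- by case.
Qed.

Lemma segment_cardinal (t : Theta) : exists N : Type,
  [set: N] #= segment t /\ small [set: N -> Lambda].
Proof.
have [e [N [Ncard /card_eqPle[Nt tN]]]] := exists_cardinal t Theta_card.1.
exists N; split; first exact/card_eqPle.
apply: Lambda_power => //; split; first by apply: card_le_trans Nt _; apply: card_leT.
by move=> /card_le_trans/(_ Nt); apply: card_ltK_segment.
Qed.

Lemma Lambda_distinct : exists a b : Lambda, a <> b.
Proof.
have [a _] := infinite_setN0 Lambda_infinite; exists a; apply: contrapT => nb.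
apply: Lambda_infinite; apply: sub_finite_set (finite_set1 a) => b _ /=.
by apply: contrapT => ba; apply: nb; exists b => ab; apply: ba.
Qed.

(** If $\lambda<\theta$, the power hypothesis applies to the exponent [Lambda] itself and gives
    $\lambda^\lambda\le\lambda$, against Cantor's diagonal argument. *)
Lemma Theta_small : small [set: Theta].
Proof.
apply: contrapT => nle; have [t Lt] := card_ltK_ex Theta_card nle.
have LTh : card_lt [set: Lambda] [set: Theta].
  by split=> //; apply: card_le_trans Lt _; apply: card_leT.
have /card_leE[|g gE] := Lambda_power Lambda_card LTh; first by exists id.
have [a [b ab]] := Lambda_distinct.
have : [set: Lambda -> Lambda] (fun l => if g l l == a then b else a) by [].
rewrite gE => -[l _ /(congr1 (@^~ l))]; case: eqP => [-> /ab//|nga ga].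
exact: nga.
Qed.

(** A nonempty subset no larger than [segment t] is the range of an enumeration of [A] by [Lambda]
    composed with a function into [Lambda] from an index set of that size. The power hypothesis
    bounds these functions, and there are only $\theta\le\lambda$ choices of [t]. *)
Lemma small_lt_subsets U (A : set U) : small A ->
  small [set X : set U | X `<=` A /\ lt_Theta X].
Proof.
move=> sA; pose F (t : Theta) := [set X : set U | X `<=` A /\ X #<= segment t].
apply: small_sub (@small_bigcup _ _ [set: Theta] F Theta_small _).
  by move=> X [XA /(card_ltK_ex Theta_card)[t Xt]]; exists t.
move=> t _; have [A0|/set0P A0] := eqVneq A set0.
  apply: small_sub (small_finite (finite_set1 (set0 : set U))) => X [].
  by rewrite A0 subset0.
have [p pE] := card_leE sA A0; have [N [/card_eqPle[_ tN] sN]] := segment_cardinal t.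
apply: small_sub (small_setU (small_finite (finite_set1 (set0 : set U)))
  (small_image (fun h : N -> Lambda => range (p \o h)) sN)) => X [XA Xt].
have [->|/set0P X0] := eqVneq X set0; [by left|right].
have [g gE] := card_leE (card_le_trans Xt tN) X0.
have hP m : exists l, p l = g m.
  have : A (g m) by apply: XA; rewrite gE; exists m.
  by rewrite pE => -[l _ <-]; exists l.
have [h hE] := choice hP; exists h => //.
by rewrite gE; congr (_ @` _); apply: funext => m /=.
Qed.

Lemma Lambda_no_max (a : Lambda) : exists b, a < b.
Proof.
apply: contrapT => nb; apply: (card_ltK_segmentS Lambda_card Lambda_infinite
  (t := a)).
apply: subset_card_le => b _ /=; rewrite leNgt; apply/negP => ab.
by apply: nb; exists b.
Qed.

(* Konig's theorem: a cofinal family of fewer than [Theta] elements of [Lambda]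
   would give [Lambda ^ N > Lambda] for some [N < Theta]. *)
Lemma lt_Theta_bounded U (X : set U) (f : U -> Lambda) : lt_Theta X ->
  exists a, forall x, X x -> f x <= a.
Proof.
move=> /(card_ltK_ex Theta_card)[t Xt];
  have [N [/card_eqPle[_ tN] sN]] := segment_cardinal t.
apply: contrapT => nb; have [l0 _] := infinite_setN0 Lambda_infinite.
have X0 : X !=set0.
  by apply: contrapT => X0; apply: nb; exists l0 => x Xx; case: X0; exists x.
have [k kE] := card_leE (card_le_trans Xt tN) X0.
have [|g gE] := card_leE sN; first by exists (fun=> l0).
(* Fewer than $\lambda$ indices [b] satisfy [b <= f (k m)], so some value avoids every such [g b m].
   The diagonal function [h] can then equal [g b] only if [b] bounds the family. *)
have hP m : exists l, forall b, b <= f (k m) -> g b m <> l.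
  apply: contrapT => nl.
  apply: (card_ltK_segmentS Lambda_card Lambda_infinite (t := f (k m))).
  apply: (@card_le_sub_image _ _ _ _ (fun b => g b m)) => l _; apply: contrapT => nb'.
  by apply: nl; exists l => b bk gl; apply: nb'; exists b.
have [h hE] := choice hP.
have : [set: N -> Lambda] h by [].
rewrite gE => -[b _ gb]; apply: nb; exists b => x Xx; rewrite leNgt; apply/negP => bx.
move: Xx; rewrite kE => -[m _ mx]; apply: (hE m b); last by rewrite gb.
by rewrite mx ltW.
Qed.

Lemma Lambda'_not_small : ~ small [set: Lambda'].
Proof. by case: Lambda'_succ => _ []. Qed.

(** A larger segment would be equipotent to a cardinal above $\lambda$, hence at least $\lambda^+$,
    although [Lambda'] is an initial ordinal. *)
Lemma small_segment (x : Lambda') : small (segment x).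
Proof.
case: Lambda'_succ => Kcard _ Kmin; apply: contrapT => nsx.
have [e [M [Mcard /card_eqPle[Mx xM]]]] := exists_cardinal x Kcard.1.
have nM : ~ small [set: M] by move/(card_le_trans xM).
apply: (card_ltK_segment Kcard (t := x)); apply: card_le_trans Mx.
apply: Kmin => //; split=> //; apply: contrapT => nL.
apply: nM; apply: (card_le_greedy (well_ordered_wf Mcard.1) (@lt_tricho _ _))
  => m _ le.
by apply: nL; apply: card_le_trans le (card_leT _).
Qed.

(** Iterate [F] along [Lambda]. Stages stay small because a small set has at most $\lambda$ subsets
    of size below $\theta$; by [lt_Theta_bounded], parameter sets inside the union already lie in
    one stage. [M] acts as a small elementary submodel. *)
Lemma small_closure U (F : set U -> set U -> set U) :
  (forall X Y, small (F X Y)) ->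
  exists M : set U, small M /\ forall X Y, X `<=` M -> Y `<=` M ->
    lt_Theta X -> lt_Theta Y -> F X Y `<=` M.
Proof.
move=> sF; pose G X Y := [set x | [/\ lt_Theta X, lt_Theta Y & F X Y x]].
have mono (a b : Lambda) : b <= a -> stage G b `<=` stage G a.
  by rewrite le_eqVlt => /orP[/eqP-> //|ba] x; apply: stage_lt.
exists [set x | exists a : Lambda, stage G a x]; split.
  have sst (a : Lambda) : small (stage G a).
    elim/(well_founded_ind (well_ordered_wf Lambda_card.1)): a => a IH.
    pose P (b : Lambda) := [set X | X `<=` stage G b /\ lt_Theta X].
    pose H (b : Lambda) := stage G b `|`
      [set x | exists2 XY, (P b `*` P b) XY & F XY.1 XY.2 x].
    apply: small_sub (@small_bigcup _ _ [set b | b < a] H _ _).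
    - move=> x [a' b y ba yb|a' b X Y y ba Xb Yb [lX lY Fy]].
        by exists b => //; left.
      by exists b => //; right; exists (X, Y).
    - exact: card_leT.
    move=> b ba; apply: small_setU; first exact: IH.
    apply: small_bigcup => //; apply: small_setX; apply: small_lt_subsets; exact: IH.
  apply: small_sub (@small_bigcup _ _ [set: Lambda] (stage G) _ _) => //.
  by move=> x [a ax]; exists a.
move=> X Y XM YM lX lY x Fx.
have bnd Z : Z `<=` [set x | exists a : Lambda, stage G a x] -> lt_Theta Z ->
    exists a : Lambda, Z `<=` stage G a.
  move=> ZM lZ; have [l0 _] := infinite_setN0 Lambda_infinite.
  have fP y : exists a : Lambda, Z y -> stage G a y.
    have [/ZM[a ya]|nZ] := pselect (Z y); first by exists a.
    by exists l0.
  have [f fE] := choice fP; have [a aP] := lt_Theta_bounded f lZ.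
  by exists a => y Zy; apply: mono (aP y Zy) _ (fE y Zy).
have [a Xa] := bnd X XM lX; have [b Yb] := bnd Y YM lY.
have [c ac] := Lambda_no_max (Order.max a b).
exists c; apply: (stage_op (X := X) (Y := Y) ac) => //.
- by apply: subset_trans Xa _; apply: mono; rewrite le_max lexx.
- by apply: subset_trans Yb _; apply: mono; rewrite le_max lexx orbT.
Qed.

(** * Homogeneous sets for a two-coloured graph *)

Section Coloring.
Context (U : Type) (c : color -> U -> U -> Prop).
Hypothesis c_sym : forall k x y, c k x y -> c k y x.
Hypothesis c_irrefl : forall k x, ~ c k x x.
Hypothesis c_total : forall x y, x <> y -> c red x y \/ c green x y.

Local Notation big A := ([set: Theta] #<= A).

Definition homogeneous k (A : set U) :=
  forall x y, A x -> A y -> x <> y -> c k x y.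

Definition Theta_homogeneous k (A : set U) :=
  [/\ big A, small A & homogeneous k A].

Definition joined k (A : set U) : set U := [set z | forall x, A x -> c k z x].

Lemma big_nonempty V (A : set V) : big A -> A !=set0.
Proof.
move=> bA; apply/set0P/negP => /eqP A0; rewrite A0 in bA.
have [t _] := infinite_setN0 Theta_infinite.
by move: bA => /card_le0P/seteqP[/(_ t I)].
Qed.

Lemma not_small_nonempty V (A : set V) : ~ small A -> A !=set0.
Proof. by move=> nA; apply/set0P/negP => /eqP A0; apply: nA; rewrite A0. Qed.

Lemma ex_Theta_homogeneous k (C : set U) :
  (forall X, X `<=` C -> lt_Theta X -> (C `&` joined k X) !=set0) ->
  exists2 B, B `<=` C & Theta_homogeneous k B.
Proof.
move=> H; have lt0 : lt_Theta (@set0 U).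
  by apply: card_ltK_finite => //; exact: Theta_infinite.
have [z0 _] := H _ (sub0set C) lt0.
have [t X _ XC Xt|f fP] := @transfinite_choice Theta (fun s t => s < t) setT
    U z0 C (c k) (well_ordered_wf Theta_card.1).
  have [|z [Cz zX]] := H X XC; last by exists z.
  apply: card_ltK_le (card_ltK_segment Theta_card (t := t)).
  by apply: card_le_trans Xt _; apply: subset_card_le => s [].
have fc s t : s <> t -> c k (f s) (f t).
  have [->//|[st _|ts _]] := lt_tricho s t.
    by apply: c_sym; apply: (fP t I).2.
  exact: (fP s I).2.
exists (range f); first by move=> _ [t _ <-]; have [] := fP t I.
split.
- apply: (@card_le_inj _ _ _ _ f) => [t _|s t _ _ fst]; first by exists t.
  by apply: contrapT => /fc; rewrite fst => /c_irrefl.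
- exact: small_image Theta_small.
- move=> _ _ [s _ <-] [t _ <-] fst; apply: fc => st; apply: fst.
  by rewrite st.
Qed.

Lemma ex_maximal_homogeneous k (A : set U) : exists R, [/\ R `<=` A,
  homogeneous k R & forall x, A x -> joined k R x -> R x].
Proof.
have [|R [[RA Rh] Rmax]] := @Zorn_bigcup U [set R | R `<=` A /\ homogeneous k R].
  move=> F FP tot; split; first by move=> x [X /FP[XA _] /XA].
  move=> x y [X FX Xx] [Y FY Yy].
  have [XY|YX] := tot X Y FX FY.
    by have [_ Yh] := FP Y FY; apply: Yh => //; apply: XY.
  by have [_ Xh] := FP X FX; apply: Xh => //; apply: YX.
exists R; split=> // x Ax xR; apply: contrapT => nRx.
apply: (Rmax (R `|` [set x])).
  by split; [exact: subsetUl|move=> /(_ x (or_intror erefl))].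
split; first by move=> y [/RA//|->].
move=> y z [Ry|->] [Rz|->] // yz; [exact: Rh| |exact: xR].
by apply: c_sym; apply: xR.
Qed.

(* The Erdos-Rado relation [Lambda' -> (Lambda', Theta)]. *)
Lemma not_small_homogeneous (C : set U) : ~ small C ->
  (exists R, [/\ R `<=` C, ~ small R & homogeneous red R]) \/
  (exists2 B, B `<=` C & Theta_homogeneous green B).
Proof.
move=> nC; apply: contrapT => /not_orP[nR nB].
(* [R X] is a maximal red subset of the points of [C] joined in green to [X]. By assumption it is
   small, so some small [M] is closed under [R]. *)
have [R RP] := choice (fun X => ex_maximal_homogeneous red (C `&` joined green X)).
have sR (X Y : set U) : small (R X).
  apply: contrapT => nsR; apply: nR; exists (R X).
  by have [RC Rh _] := RP X; split=> // x /RC[].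
have [M [sM Mcl]] := small_closure sR.
have [delta [Cd nMd]] : (C `\` M) !=set0.
  apply: not_small_nonempty => sCM; apply: nC.
  apply: small_sub (small_setU sCM sM) => x Cx.
  by have [Mx|nMx] := pselect (M x); [right|left].
(* Let [X] be a subset of size below $\theta$. As [delta] lies outside [M], hence outside [R X],
   maximality yields a point of [R X] that is not red to [delta]; this point prolongs [X]. *)
have [|B BC hB] := @ex_Theta_homogeneous green [set x | [/\ C x,
  M x & c green x delta]].
- move=> X XC lX; have XM : X `<=` M by move=> x /XC[].
  have RM := Mcl X X XM XM lX lX.
  have [RC Rh Rmax] := RP X.
  have [/Rmax Rd|] := pselect (joined red (R X) delta).
    case: nMd; apply: RM; apply: Rd; split=> // x /XC[_ _ xd]; exact: c_sym.
  move=> /existsNP[x /not_implyP[Rx nxd]]; exists x.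
  have [Cx xX] := RC x Rx; split=> //; split=> //; first exact: RM.
  have [|/c_sym//|] := @c_total x delta; last by [].
  by move=> xd; apply: nMd; rewrite -xd; apply: RM.
by apply: nB; exists B => // x /BC[].
Qed.

(** * Red transversals of families of positive sets *)

Section Transversal.
Context (n : nat) (V : 'I_n -> set U) (P : 'I_n -> set U -> Prop).
Hypothesis P_sub : forall i (A B : set U), A `<=` B -> P i A -> P i B.
Hypothesis P_bigcup : forall i I (J : set I) (F : I -> set U), small J ->
  P i [set x | exists2 j, J j & F j x] -> exists2 j, J j & P i (F j).
Hypothesis P_not_small : forall i A, P i A -> ~ small A.
Hypothesis P_V : forall i, P i (V i).
Hypothesis P_green : forall i A, A `<=` V i -> P i A ->
  exists2 B, B `<=` A & Theta_homogeneous green B.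
Hypothesis no_green : forall i j B D, B `<=` V i -> D `<=` V j ->
  Theta_homogeneous green B -> P j D -> ~ (D `<=` joined green B).
Hypothesis no_red : forall i B D, B `<=` V i -> D `<=` V i ->
  Theta_homogeneous red B -> P i D -> ~ (D `<=` joined red B).

Lemma P_setD i D N : P i D -> ~ P i N -> P i (D `\` N).
Proof.
move=> PD nPN; have sb : small [set: bool] by apply: small_finite;
  exact: finite_finset.
have [|[] _ //] := @P_bigcup i bool setT (fun b => if b then N else D `\` N) sb.
apply: P_sub PD => x Dx; have [Nx|nNx] := pselect (N x); first by exists true.
by exists false.
Qed.

Lemma P_nonempty i D : P i D -> D !=set0.
Proof. by move=> /P_not_small/not_small_nonempty. Qed.

(** The definable sets of the construction; [X] and [Y] will be subsets of [M] of size below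
    $\theta$, which leaves at most $\lambda$ slices. *)
Let Slice i (X Y : set U) := V i `&` joined green X `&` joined red Y.

Let common_red k (delta : 'I_n -> U) : set U :=
  [set z | forall j : 'I_n, (j < k)%N -> c red z (delta j)].

Section Model.
Context (M : set U) (sM : small M).

Let ok X := X `<=` M /\ lt_Theta X.

Hypothesis M_model : forall i X Y, ok X -> ok Y -> P i (Slice i X Y) ->
  exists2 B, B `<=` Slice i X Y `&` M & Theta_homogeneous green B.

Let ok0 : ok set0.
Proof.
by split=> //; apply: card_ltK_finite => //; exact: Theta_infinite.
Qed.

Let okU X Y : ok X -> ok Y -> ok (X `|` Y).
Proof.
move=> [XM lX] [YM lY]; split; first by rewrite subUset.
exact (card_ltKU Theta_card Theta_infinite lX lY).
Qed.

Let small_ok : small [set X | ok X].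
Proof. exact: small_lt_subsets. Qed.

Let Fam_ok (Fam : set (set U)) := forall B, Fam B ->
  [/\ Theta_homogeneous green B, B `<=` M & exists i, B `<=` V i].

(** The third clause stands in for elementarity of [M]. The fourth lets the members of [Fam] be cut
    down to the red neighbourhood of [d] while keeping size at least $\theta$. *)
Let generic i (Fam : set (set U)) : set U := [set d | [/\ V i d, ~ M d,
  forall X Y, ok X -> ok Y -> Slice i X Y d -> P i (Slice i X Y) &
  forall B, Fam B -> big (B `&` joined red [set d])]].

(* If [B `&` joined red [set d]] is not big for positively many [d], it is a
   fixed set [X] for positively many of them, all joined in green to [B `\` X]. *)
Lemma P_generic i Fam D : small Fam -> Fam_ok Fam ->
  D `<=` V i -> P i D -> P i (D `&` generic i Fam).
Proof.
move=> sFam Famok DV PD.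
have nM : ~ P i M by move/P_not_small.
pose J1 := [set XY | [/\ ok XY.1, ok XY.2 & ~ P i (Slice i XY.1 XY.2)]].
have sJ1 : small J1.
  apply: small_sub (small_setX small_ok small_ok) => XY [okX okY _].
  by split.
have nN1 : ~ P i [set x | exists2 XY, J1 XY & Slice i XY.1 XY.2 x].
  by move=> /(P_bigcup sJ1)[XY []].
pose bad (B : set U) := [set d | [/\ V i d,
  ~ M d & lt_Theta (B `&` joined red [set d])]].
have nN2 : ~ P i [set x | exists2 B, Fam B & bad B x].
  move=> /(P_bigcup sFam)[B /Famok[[bB sB hB] BM [j BV]] PB].
  pose J := [set X | X `<=` B /\ lt_Theta X].
  pose F X := [set d | bad B d /\ B `&` joined red [set d] = X].
  have [||X [XB lX] PX] := @P_bigcup i _ J F; first exact: small_lt_subsets.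
    by apply: P_sub PB => d Bd; exists (B `&` joined red [set d]) => //;
      split=> [x []|]//; case: Bd.
  apply: (@no_green j i (B `\` X) (F X)) => //.
  - by move=> x [/BV].
  - by move=> d [[]].
  - split; last by move=> x y [Bx _] [By _]; apply: hB.
      apply: contrapT => nbig.
      have := card_ltKU Theta_card Theta_infinite lX nbig.
      by rewrite setDUK//; apply.
    by apply: small_sub sB => x [].
  - move=> d [[Vd nMd _] dX] x [Bx nXx]; apply: c_sym.
    have xd : x <> d by move=> xd; apply: nMd; rewrite -xd; apply: BM.
    have [rxd|//] := c_total xd.
    by case: nXx; rewrite -dX; split=> // _ ->.
apply: P_sub (P_setD (P_setD (P_setD PD nM) nN1) nN2) => d [[[Dd nMd] nd1] nd2].
split=> //; split=> //; first exact: DV.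
- move=> X Y okX okY Sd; apply: contrapT => nP; apply: nd1.
  by exists (X, Y).
- move=> B FB; apply: contrapT => nbig; apply: nd2; exists B => //.
  by split=> //; apply: DV.
Qed.

(** [Fam] holds green sets inside [M] that witness reflection, red to the first [k] points of
    [delta]: in every positive slice, and in every slice with red parameters only that contains one
    of these points. The former carries the induction on [k]; the final construction draws on the
    latter. *)
Let invariant k delta (Fam : set (set U)) := [/\ small Fam, Fam_ok Fam,
  forall i X Y, ok X -> ok Y -> P i (Slice i X Y) ->
    exists2 B, Fam B & B `<=` Slice i X Y `&` common_red k delta,
  forall j : 'I_n, (j < k)%N -> V j (delta j) &
  forall (j : 'I_n) Y, (j < k)%N -> ok Y -> Slice j set0 Y (delta j) ->
    exists2 B, Fam B & B `<=` Slice j set0 Y `&` common_red k delta].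

(* Otherwise let [C] be the set on the left. A generic [d'] in the slice is joined
   in green to some [X `<=` C] that cannot be prolonged in [C], so that the part
   of [C] that is joined in green to [X] is red to [d']; as [X] is the same for
   positively many [d'], a red set built there contradicts [no_red]. *)
Lemma generic_green k delta Fam (i : 'I_n) d Y :
  invariant k delta Fam -> generic i Fam d -> ok Y -> Slice i set0 Y d ->
  exists2 B, B `<=` Slice i set0 Y `&` M `&` common_red k delta `&` joined red [set d]
    & Theta_homogeneous green B.
Proof.
move=> [sFam Famok Fam1 _ _] [Vd nMd dP dFam] okY Sd.
set C := (X in exists2 B, B `<=` X & _); apply: contrapT => nB.
have PS : P i (Slice i set0 Y) by apply: dP.
have star d' : ~ M d' -> exists X, [/\ X `<=` C, lt_Theta X, joined green X d' &
    C `&` joined green X `<=` joined red [set d']].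
  move=> nMd'; apply: contrapT => nX.
  have [|B BC hB] := @ex_Theta_homogeneous green (C `&` joined green [set d']).
    move=> X XC lX; have [XC1 Xd'] : X `<=` C /\ joined green X d'.
      by split=> x /XC[] // _ /(_ d' erefl)/c_sym.
    apply: contrapT => nz; apply: nX; exists X; split=> // z [Cz zX] _ ->.
    have zd' : z <> d' by move=> zd'; apply: nMd'; rewrite -zd'; case: Cz => [[[]]].
    have [//|gzd'] := c_total zd'.
    by case: nz; exists z; split=> //; split=> // _ ->.
  by apply: nB; exists B => // x /BC[].
pose J := [set X | X `<=` C /\ lt_Theta X].
have CM : C `<=` M by move=> x [[[]]].
have sJ : small J by apply: small_lt_subsets; apply: small_sub sM.
pose D0 := Slice i set0 Y `&` generic i Fam.
have PD0 : P i D0 by apply: P_generic => // x [[]].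
pose F X := [set d' | [/\ D0 d', joined green X d' &
    C `&` joined green X `<=` joined red [set d']]].
have [|X [XC lX] PX] := @P_bigcup i _ J F sJ.
  apply: P_sub PD0 => d' [Sd' gd']; have [_ nMd' _ _] := gd'.
  have [X [XC lX Xd' XCd']] := star d' nMd'.
  by exists X; split.
have [d' [[Sd' [Vd' nMd' d'P _]] Xd' XCd']] := P_nonempty PX.
(* Two generic points cooperate. Since [d'] lies in the slice for [X] and the union of [Y] and [Z],
   that slice is positive and contains a member of [Fam]; [d] is red to some point [z] of this
   member, and [z] prolongs [Z] inside [C]. *)
have [|B BC hB] := @ex_Theta_homogeneous red (C `&` joined green X).
  move=> Z ZC lZ; have okX : ok X by split=> // x /XC/CM.
  have okZ : ok Z by split=> // x /ZC[/CM].
  have SXd' : Slice i X (Y `|` Z) d'.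
    split; first by split.
    move=> y [|/ZC/XCd'/(_ d' erefl)/c_sym//].
    by case: Sd' => _; apply.
  have [B FB BS] := Fam1 i X (Y `|` Z) okX (okU okY okZ) (d'P _ _ okX (okU
    okY okZ) SXd').
  have [z [Bz zd]] := big_nonempty (dFam B FB).
  have [[[Vz zX] zYZ] zk] := BS z Bz; exists z.
  have [_ BM _] := Famok B FB.
  split; last by move=> y Zy; apply: zYZ; right.
  split=> //; split=> //; split=> //; split; last exact: BM.
  by split=> [|y Yy]; [split|apply: zYZ; left].
apply: (@no_red i B (F X)) => //.
- by move=> x /BC[[[[[[]]]]]].
- by move=> x [[[[]]]].
- move=> x [_ _ Cx] b Bb; apply: c_sym.
  by apply: Cx (BC b Bb) x erefl.
Qed.

Lemma ex_generic k : (k <= n)%N -> exists delta Fam, invariant k delta Fam.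
Proof.
elim: k => [_|k IH kn].
  (* For [k = 0] nothing is asked of [delta]. [Fam] starts with one green set of [M] for each
     positive slice; [set0] is a default elsewhere. *)
  have [delta _] := choice (fun i => P_nonempty (P_V i)).
  have gP (q : 'I_n * (set U * set U)) : exists B, ok q.2.1 -> ok q.2.2 ->
      P q.1 (Slice q.1 q.2.1 q.2.2) ->
      B `<=` Slice q.1 q.2.1 q.2.2 `&` M /\ Theta_homogeneous green B.
    case: q => i [X Y] /=.
    have [[okX okY PS]|nq] := pselect [/\ ok X, ok Y & P i (Slice i X Y)].
      by have [B BS hB] := M_model okX okY PS; exists B.
    by exists set0 => okX okY PS; case: nq.
  have [g gE] := choice gP.
  pose J := [set q : 'I_n * (set U * set U) |
    [/\ ok q.2.1, ok q.2.2 & P q.1 (Slice q.1 q.2.1 q.2.2)]].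
  exists delta, (g @` J); split=> //.
  - apply: small_image; have sI : small [set: 'I_n] by apply: small_finite;
    exact: finite_finset.
    apply: small_sub (small_setX sI (small_setX small_ok small_ok)) => q [okX okY _].
    by split.
  - move=> _ [q [okX okY PS] <-]; have [gS hg] := gE q okX okY PS; split=> //.
      by move=> x /gS[].
    by exists q.1 => x /gS[[[]]].
  - move=> i X Y okX okY PS; exists (g (i, (X, Y))); first by exists (i, (X, Y)).
    by have [gS _] := gE (i, (X, Y)) okX okY PS => x /gS[Sx _]; split.
have [delta [Fam inv]] := IH (ltnW kn).
pose i := Ordinal kn; have [sFam Famok Fam1 Vdelta Fam2] := inv.
have [d [_ gd]] := P_nonempty (P_generic sFam Famok (@subset_refl _ (V i)) (P_V i)).
have [Vd nMd dP dFam] := gd.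
pose delta' j := if j == i then d else delta j.
have ltS_neq (j : 'I_n) : (j < k.+1)%N -> j <> i -> (j < k)%N.
  rewrite ltnS leq_eqVlt => /predU1P[jk ji|//].
  by case: ji; apply: val_inj.
have cr : common_red k.+1 delta' = common_red k delta `&` joined red [set d].
  apply/seteqP; split=> z.
    move=> zd; split=> [j jk|_ ->]; last by have := zd i (leqnn _);
      rewrite /delta' eqxx.
    have := zd j (ltnW jk); rewrite /delta'; case: eqP => // ji.
    by move: jk; rewrite ji /= ltnn.
  move=> [zk zd] j jk; rewrite /delta'; case: eqP => [_|ji]; first exact: zd.
  by apply: zk; apply: ltS_neq jk ji.
have gP Y : exists B, ok Y -> Slice i set0 Y d ->
    B `<=` Slice i set0 Y `&` M `&` common_red k delta `&` joined red [set d] /\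
    Theta_homogeneous green B.
  have [[okY Sd]|nY] := pselect (ok Y /\ Slice i set0 Y d).
    by have [B BS hB] := generic_green inv gd okY Sd; exists B.
  by exists set0 => okY Sd; case: nY.
have [g gE] := choice gP.
(* The old sets are cut to the red neighbourhood of [d]; the new ones serve the slices through [d]
   itself. *)
pose Fam' := [set B `&` joined red [set d] | B in Fam] `|`
  g @` [set Y | ok Y /\ Slice i set0 Y d].
exists delta', Fam'; split.
- apply: small_setU; first exact: small_image.
  by apply: small_image; apply: small_sub small_ok => Y [].
- move=> _ [[B FB <-]|[Y [okY Sd] <-]].
    have [[bB sB hB] BM [j BV]] := Famok B FB; split.
    + split; [exact: dFam|by apply: small_sub sB => x []|].
      by move=> x y [Bx _] [By _]; apply: hB.
    + by move=> x [/BM].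
    + by exists j => x [/BV].
  have [gS hg] := gE Y okY Sd; split=> //; first by move=> x /gS[[[]]].
  by exists i => x /gS[[[[[]]]]].
- move=> j X Y okX okY /(Fam1 j X Y okX okY)[B FB BS].
  exists (B `&` joined red [set d]); first by left; exists B.
  by rewrite cr => x [/BS[Sx xk] xd].
- move=> j jk; rewrite /delta'; case: eqP => [->//|ji].
  by apply: Vdelta; apply: ltS_neq.
- move=> j Y jk okY; rewrite /delta' cr.
  case: eqP => [-> Sd|ji Sj].
    have [gS _] := gE Y okY Sd; exists (g Y); first by right; exists Y.
    by move=> x /gS[[[Sx _] xk] xd].
  have [B FB BS] := Fam2 j Y (ltS_neq j jk ji) okY Sj.
  exists (B `&` joined red [set d]); first by left; exists B.
  by move=> x [/BS[Sx xk] xd].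
Qed.

(** Recursion of length [Theta], adding one point of each [V i] per step. The set [Y] of earlier
    points is red to [delta i], so [delta i] lies in [Slice i set0 Y]; the invariant reflects it to
    a point of [M] that is red to [Y] and again to every [delta j]. *)
Lemma model_transversal : exists X : 'I_n -> set U,
  (forall i, X i `<=` V i /\ big (X i)) /\
  (forall i j x y, X i x -> X j y -> x <> y -> c red x y).
Proof.
have [delta [Fam [_ Famok _ Vdelta Fam2]]] := ex_generic (leqnn n).
pose C := [set v : 'I_n -> U | forall i, [/\ V i (v i),
  M (v i) & common_red n delta (v i)]].
pose rho (v w : 'I_n -> U) := forall i j, c red (v i) (w j).
have [t X _ XC Xt|f fP] := @transfinite_choice Theta (fun s t => s < t) setT
    _ delta C rho (well_ordered_wf Theta_card.1).
  pose Y := [set x | exists j, [set v j | v in X] x].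
  have okY : ok Y.
    split; first by move=> _ [j [v Xv <-]]; have [] := XC v Xv j.
    apply: (card_ltK_bigcup Theta_card Theta_infinite) => j.
    apply: card_ltK_le (card_image_le _ _) _.
    apply: card_ltK_le (card_ltK_segment Theta_card (t := t)).
    by apply: card_le_trans Xt _; apply: subset_card_le => s [].
  have vP i : exists x, [/\ V i x, M x, common_red n delta x & joined red Y x].
    have [|B FB BS] := Fam2 i Y (ltn_ord i) okY.
      split; first by split=> //; apply: Vdelta.
      move=> _ [j [v Xv <-]]; apply: c_sym.
      by have [_ _] := XC v Xv j; apply.
    have [[bB _ _] BM _] := Famok B FB; have [x Bx] := big_nonempty bB.
    by have [[[Vx _] xY] xd] := BS x Bx; exists x; split=> //; apply: BM.
  have [v vE] := choice vP; exists v; first by move=> i; have [] := vE i.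
  by move=> w Xw i j; have [_ _ _] := vE i; apply; exists j, w.
have fc s t i j : s <> t -> c red (f s i) (f t j).
  have [->//|[st _|ts _]] := lt_tricho s t.
    by apply: c_sym; apply: (fP t I).2.
  exact: (fP s I).2.
have [t0 _] := infinite_setN0 Theta_infinite.
(* Points added in the same step are not compared with each other. Sending the pairs [(t, i)] to
   distinct steps makes distinct points of the transversal come from different steps. *)
have [h [_ hI]] := card_le_injE t0 (card_leK_muln Theta_card Theta_infinite n).
exists (fun i => range (fun t => f (h (t, i)) i)); split=> [i|i j].
  split; first by move=> _ [t _ <-]; have [] := (fP (h (t, i)) I).1 i.
  apply: (@card_le_inj _ _ _ _ (fun t => f (h (t, i)) i)) => [t _|s t _ _ fst].
    by exists t.
  apply: contrapT => st; apply: (@c_irrefl red (f (h (s, i)) i)); rewrite {2}fst.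
  by apply: fc => /hI => /(_ I I)[].
move=> _ _ [s _ <-] [t _ <-] fst; apply: fc => hst; apply: fst.
by have [-> ->] := hI _ _ I I hst.
Qed.

End Model.

Lemma red_transversal : exists X : 'I_n -> set U,
  (forall i, X i `<=` V i /\ big (X i)) /\
  (forall i j x y, X i x -> X j y -> x <> y -> c red x y).
Proof.
(* The chosen set is small even where the slice is not positive, so that [small_closure] applies to
   all parameter sets. *)
have gP (q : 'I_n * (set U * set U)) : exists B, small B /\
    (P q.1 (Slice q.1 q.2.1 q.2.2) ->
      B `<=` Slice q.1 q.2.1 q.2.2 /\ Theta_homogeneous green B).
  have [PS|nP] := pselect (P q.1 (Slice q.1 q.2.1 q.2.2)); last by exists set0.
  have [|B BS hB] := P_green _ PS; first by move=> x [[]].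
  by exists B; split=> //; case: hB.
have [g gE] := choice gP.
pose F X Y := [set x | exists2 i, [set: 'I_n] i & g (i, (X, Y)) x].
have sF X Y : small (F X Y).
  apply: small_bigcup => [|i _]; first by apply: small_finite; exact: finite_finset.
  by have [] := gE (i, (X, Y)).
have [M [sM Mcl]] := small_closure sF.
apply: (model_transversal sM) => i X Y [XM lX] [YM lY] PS.
have [_ /(_ PS)[gS hg]] := gE (i, (X, Y)); exists (g (i, (X, Y))) => //.
move=> x gx; split; first exact: gS.
by apply: (Mcl X Y) => //; exists i.
Qed.

End Transversal.
End Coloring.

(** * Positive subsets of finite powers of [Lambda'] *)

(** The outermost quantifier falls on the first, most significant coordinate, so that positive sets
    have increasing positive rows. On the single point of [ord_exp Lambda' 0] the ideal contains
    only the empty set. *)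
Fixpoint pos (r : nat) : set (ord_exp Lambda' r) -> Prop :=
  match r return set (ord_exp Lambda' r) -> Prop with
  | 0 => fun S => S !=set0
  | r'.+1 => fun S =>
      ~ small [set a : Lambda' | pos (r := r') [set x | S (a, x)]]
  end.

Lemma pos_sub r (S T : set (ord_exp Lambda' r)) : S `<=` T -> pos S -> pos T.
Proof.
elim: r S T => [|r IH] S T ST /=; first by move=> [x /ST Tx]; exists x.
by apply: contra_not; apply: small_sub => a; apply: IH => x /ST.
Qed.

Lemma pos_bigcup r I (J : set I) (F : I -> set (ord_exp Lambda' r)) : small J ->
  pos [set x | exists2 j, J j & F j x] -> exists2 j, J j & pos (F j).
Proof.
move=> sJ; elim: r F => [|r IH] F /=; first by move=> [x [j Jj Fx]];
  exists j => //; exists x.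
move=> nsm; apply: contrapT => nF; apply: nsm.
pose G j := [set a : Lambda' | pos [set x | F j (a, x)]].
apply: small_sub (@small_bigcup _ _ J G sJ _); first by move=> a /IH.
by move=> j Jj; apply: contrapT => nG; apply: nF; exists j.
Qed.

Lemma pos_nonempty r (S : set (ord_exp Lambda' r)) : pos S -> S !=set0.
Proof.
elim: r S => [//|r IH] S /= /not_small_nonempty[a /IH[x Sx]].
by exists (a, x).
Qed.

Lemma pos_not_small r (S : set (ord_exp Lambda' r.+1)) : pos S -> ~ small S.
Proof.
move=> /= nS sS; apply: nS; apply: small_sub (small_image (@fst Lambda' _) sS).
by move=> a /pos_nonempty[x Sx]; exists (a, x).
Qed.

Lemma pos_setT r : @pos r setT.
Proof.
elim: r => [|r IH] /=; first by exists ord0.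
rewrite (_ : [set a | _] = setT); first exact: Lambda'_not_small.
by apply/seteqP; split=> // a _; apply: pos_sub IH.
Qed.

(** Each [f j] excludes only the small set of points up to it; this is the regularity of
    $\lambda^+$. *)
Lemma not_small_above (A : set Lambda') I (J : set I) (f : I -> Lambda') : small J ->
  ~ small A -> ~ small [set a | A a /\ forall j, J j -> f j < a].
Proof.
move=> sJ nA sA; apply: nA; pose G j := segment (f j) `|` [set f j].
have sG j : J j -> small (G j).
  by move=> _; apply: small_setU;
    [exact: small_segment|exact/small_finite/finite_set1].
apply: small_sub (small_setU sA (small_bigcup sJ sG)) => a Aa.
have [[j Jj]|nj] := pselect (exists2 j, J j & ~ f j < a).
  move=> /negP; rewrite -leNgt le_eqVlt => /predU1P[->|af]; right; exists j => //.
    by right.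
  by left.
by left; split=> // j Jj; apply: contrapT => nfa; apply: nj; exists j.
Qed.

Lemma pos_above r (S Z : set (ord_exp Lambda' r.+1)) : small Z -> pos S ->
  pos [set x | S x /\ forall z, Z z -> z < x].
Proof.
move=> sZ pS; have := not_small_above (f := @fst Lambda' _) sZ pS.
apply: contra_not; apply: small_sub => a [/= pa Za]; apply: pos_sub pa => x Sx.
by split=> // z Zz; rewrite ord_mul_ltE /= Za.
Qed.

Lemma pos_rows r (S : set (ord_exp Lambda' r.+1)) : pos S ->
  exists a : nat -> Lambda', (forall i, pos [set x | S (a i, x)]) /\
    forall i j, (i < j)%N -> a i < a j.
Proof.
move=> /= pS; apply: (ex_increasing (A := [set a | pos [set x | S (a, x)]])).
  exact: not_small_nonempty.
move=> x _; have s1 : small [set: unit] by apply: small_finite; exact: finite_finset.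
have [y [Ay xy]] := not_small_nonempty (not_small_above (f := fun=> x) s1 pS).
by exists y => //; apply: (xy tt).
Qed.

(** * Blocks *)

Section Blocks.
Context (dW : Order.disp_t) (W : orderType dW) (wo_W : well_ordered W).
Context (c : color -> W -> W -> Prop).
Hypothesis c_sym : forall k x y, c k x y -> c k y x.
Hypothesis c_irrefl : forall k x, ~ c k x x.
Hypothesis c_total : forall x y, x <> y -> c red x y \/ c green x y.

Local Notation big A := ([set: Theta] #<= A).

(** Blocks have size at least $\theta$; order type [Theta] is extracted only at the end. Indexing by
    [nat] allows a block to be put in front by a shift. *)
Definition blocks k m (D : set W) := exists X : nat -> set W,
  [/\ forall i, (i < m)%N -> X i `<=` D /\ big (X i),
      forall i j x y, (i < j < m)%N -> X i x -> X j y -> x < y &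
      homogeneous c k [set x | exists2 i, (i < m)%N & X i x]].

Lemma blocks0 k D : blocks k 0 D.
Proof.
exists (fun=> set0); split=> [//|i j x y|x y []//].
by rewrite ltn0 andbF.
Qed.

Lemma blocks_sub k m D D' : D `<=` D' -> blocks k m D -> blocks k m D'.
Proof.
move=> DD' [X [XD XX Xh]]; exists X; split=> // i /XD[XD' bX].
by split=> // x /XD'/DD'.
Qed.

Lemma homogeneousU k A B : homogeneous c k A -> homogeneous c k B ->
  B `<=` joined c k A -> homogeneous c k (A `|` B).
Proof.
move=> hA hB BA x y [Ax|Bx] [Ay|By] xy; [exact: hA| | |exact: hB].
  by apply: c_sym; apply: BA.
exact: BA.
Qed.

Lemma homogeneous_sub k A B : A `<=` B -> homogeneous c k B -> homogeneous c k A.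
Proof. by move=> AB hB x y /AB Bx /AB By; apply: hB. Qed.

Lemma blocks_front k m B D D' : Theta_homogeneous c k B -> B `<=` D ->
  D' `<=` D -> D' `<=` joined c k B -> (forall x y, B x -> D' y -> x < y) ->
  blocks k m D' -> blocks k m.+1 D.
Proof.
move=> [bB _ hB] BD D'D D'B BD' [X [XD' XX hX]].
exists (fun i => if i is j.+1 then X j else B); split.
- by move=> [//|i] /XD'[XiD' bX]; split=> // x /XiD'/D'D.
- move=> [|i] [|j] x y //; last exact: XX.
  by move=> /= jm Bx Xy; apply: BD' => //; apply: (XD' _ jm).1.
- apply: (@homogeneous_sub _ _ (B `|` [set x | exists2 i, (i < m)%N & X i x])).
    by move=> x [[|i] im Xx]; [left|right; exists i].
  apply: homogeneousU => // x [i im Xx]; apply: D'B.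
  exact: (XD' i im).1.
Qed.

Lemma blocks_back k m B D D' : Theta_homogeneous c k B -> B `<=` D ->
  D' `<=` D -> D' `<=` joined c k B -> (forall x y, B x -> D' y -> y < x) ->
  blocks k m D' -> blocks k m.+1 D.
Proof.
move=> [bB _ hB] BD D'D D'B BD' [X [XD' XX hX]].
exists (fun i => if (i < m)%N then X i else B); split.
- by move=> i _; case: ifP => // /XD'[XiD' bX]; split=> // x /XiD'/D'D.
- move=> i j x y /andP[ij jm]; have im : (i < m)%N := leq_trans ij jm.
  rewrite im; case: ifP => jm'; first by apply: XX; rewrite ij.
  by move=> Xx By; apply: BD' => //; apply: (XD' _ im).1.
- apply: (@homogeneous_sub _ _ (B `|` [set x | exists2 i, (i < m)%N & X i x])).
    by move=> x [i _]; case: ifP => im Xx; [right; exists i|left].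
  apply: homogeneousU => // x [i im Xx]; apply: D'B.
  exact: (XD' i im).1.
Qed.

Lemma not_small_big V (A : set V) : ~ small A -> big A.
Proof.
move=> nA; apply: contrapT => /(card_ltK_ex Theta_card)[t At]; apply: nA.
by apply: card_le_trans At _; apply: card_le_trans (card_leT _) Theta_small.
Qed.

Lemma big_subset V (A : set V) : big A -> exists B, [/\ B `<=` A, big B & small B].
Proof.
move=> bA; have [v _] := big_nonempty bA.
have [f [fA fI]] := card_le_injE v bA.
exists (range f); split; first by move=> _ [t _ <-]; exact: fA.
  by apply: (@card_le_inj _ _ _ _ f) => // t _; exists t.
exact: small_image Theta_small.
Qed.

(** Once [R] is cut down to a set whose proper initial segments are small, the part above any small
    subset is still not small, so blocks can be split off from the bottom repeatedly. *)
Lemma not_small_blocks k m (R : set W) : ~ small R -> homogeneous c k R ->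
  blocks k m R.
Proof.
move=> nR hR; have [R0 [R0R nR0 R0s]] : exists R0, [/\ R0 `<=` R, ~ small R0 &
    forall y, R0 y -> small [set x | R0 x /\ x < y]].
  have [[w Pw]|nw] := pselect (exists w, ~ small [set x | R x /\ x < w]); last first.
    by exists R; split=> // y _; apply: contrapT => ny; apply: nw; exists y.
  have [|{Pw}w nw wmin] := well_ordered_min wo_W
    (A := [set w | ~ small [set x | R x /\ x < w]]); first by exists w.
  exists [set x | R x /\ x < w]; split=> // [x []//|y [Ry yw]].
  apply: contrapT => ny; move: yw; rewrite ltNge => /negP; apply; apply: wmin.
  by apply: contra_not ny; apply: small_sub => x [[]].
suff H : forall D, D `<=` R0 -> ~ small D -> blocks k m D.
  exact: blocks_sub R0R (H R0 (@subset_refl _ _) nR0).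
elim: m => [|m IH] D DR0 nD; first exact: blocks0.
have [B [BD bB sB]] := big_subset (not_small_big nD).
pose below b := [set x | R0 x /\ x < b] `|` [set b].
have sbelow b : B b -> small (below b).
  move=> Bb; apply: small_setU; first by apply: R0s; apply: DR0; apply: BD.
  exact/small_finite/finite_set1.
pose D' := D `\` [set x | exists2 b, B b & below b x].
have nD' : ~ small D'.
  move=> sD'; apply: nD; apply: small_sub (small_setU sD' (small_bigcup sB sbelow)).
  by move=> x Dx; have [?|?] := pselect (exists2 b, B b & below b x); [right|left].
have BD' x y : B x -> D' y -> x < y.
  move=> Bx [Dy ny]; rewrite ltNge; apply/negP; rewrite le_eqVlt => /predU1P[yx|yx].
    by apply: ny; exists x => //; right.
  by apply: ny; exists x => //; left; split=> //; apply: DR0.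
have D'D : D' `<=` D by move=> x [].
have DR : D `<=` R by apply: subset_trans DR0 R0R.
apply: (blocks_front (B := B) (D' := D')) => //.
- by split=> //; apply: homogeneous_sub hR; apply: subset_trans BD DR.
- move=> y D'y x Bx; apply: hR; [exact/DR/D'D|exact/DR/BD|].
  by move=> xy; have := BD' x y Bx D'y; rewrite xy ltxx.
- by apply: IH => //; apply: subset_trans D'D DR0.
Qed.

(** * The induction step from [r] to [r + 1] *)

Section Step.
Context (r n : nat) (e : 'I_n -> ord_exp Lambda' r.+1 -> W).
Context (S : 'I_n -> set (ord_exp Lambda' r.+1)) (D : set W).
Hypothesis e_mono : forall k x y, x < y -> e k x < e k y.
Hypothesis e_lt : forall (k l : 'I_n) x y, (k < l)%N -> e k x < e l y.
Hypothesis S_pos : forall k, pos (S k).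
Hypothesis eSD : forall k x, S k x -> D (e k x).
Hypothesis IH : forall (e' : 'I_n -> ord_exp Lambda' r -> W) S' D',
  (forall k x y, x < y -> e' k x < e' k y) ->
  (forall (k l : 'I_n) x y, (k < l)%N -> e' k x < e' l y) ->
  (forall k, pos (S' k)) -> (forall k x, S' k x -> D' (e' k x)) ->
  blocks red n D' \/ blocks green r D'.
Hypothesis no_red_blocks : ~ blocks red n D.
Hypothesis no_green_blocks : ~ blocks green r.+1 D.

Let P k (A : set W) := pos [set x | S k x /\ A (e k x)].
Let V k := e k @` S k.

Let e_inj k : injective (e k).
Proof.
move=> x y exy; case: (ltgtP x y) => // /(e_mono k); by rewrite exy ltxx.
Qed.

Let VD k : V k `<=` D.
Proof. by move=> _ [x /eSD ? <-]. Qed.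

Let P_sub k A B : A `<=` B -> P k A -> P k B.
Proof. by move=> AB; apply: pos_sub => x [Sx /AB]. Qed.

Let P_bigcup k I (J : set I) (F : I -> set W) : small J ->
  P k [set x | exists2 j, J j & F j x] -> exists2 j, J j & P k (F j).
Proof.
move=> sJ PF; apply: (pos_bigcup (F := fun j => [set x | S k x /\ F j (e k x)]) sJ).
by apply: pos_sub PF => x [Sx [j Jj Fx]]; exists j.
Qed.

Let small_preimage k (A : set W) : small A -> small (e k @^-1` A).
Proof.
by apply: card_le_trans; apply: (@card_le_inj _ _ _ _ (e k)) => // x y _ _ /e_inj.
Qed.

Let P_not_small k A : P k A -> ~ small A.
Proof.
move=> /pos_not_small + sA; apply.
by apply: small_sub (small_preimage k sA) => x [].
Qed.

Let P_V k : P k (V k).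
Proof.
by apply: (pos_sub (S := S k)) => // x Sx; split=> //; exists x.
Qed.

Let P_above k A Z : small Z -> Z `<=` V k -> P k A ->
  P k [set x | A x /\ forall z, Z z -> z < x].
Proof.
move=> sZ ZV /(pos_above (small_preimage k sZ)).
apply: pos_sub => x [[Sx Ax] xZ]; split=> //; split=> // z Zz.
by have [y Sy yz] := ZV z Zz; rewrite -yz; apply: e_mono; apply: xZ; rewrite /= yz.
Qed.

(** In the other case of Erdos-Rado, a red set that is not small already contains [n] red blocks. *)
Let P_green k A : A `<=` V k -> P k A ->
  exists2 B, B `<=` A & Theta_homogeneous c green B.
Proof.
move=> AV /P_not_small/(not_small_homogeneous c_sym c_irrefl c_total)[|//].
move=> [R [RA nR hR]]; case: no_red_blocks.
apply: blocks_sub (not_small_blocks n nR hR).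
by apply: subset_trans RA _; apply: subset_trans AV (VD (k := k)).
Qed.

Let no_green i j B A : B `<=` V i -> A `<=` V j ->
  Theta_homogeneous c green B -> P j A -> ~ (A `<=` joined c green B).
Proof.
move=> BV AV hB PA AB; have [_ sB _] := hB.
(* Only the part of [B] in the copy of [A] can interleave with [A]; the rows are taken above it. *)
pose Z := B `&` V j.
have sZ : small Z by apply: small_sub sB => x [].
have ZV : Z `<=` V j by move=> x [].
pose A' := [set x | A x /\ forall z, Z z -> z < x].
have [a [pa a_lt]] := pos_rows (P_above sZ ZV PA).
pose e' (l : 'I_n) x := e j (a l, x).
pose S' (l : 'I_n) := [set x | S j (a l, x) /\ A' (e' l x)].
pose D' := A' `&` V j.
have A'D : A' `<=` D by move=> x [/AV/VD].
have [||||bl|bl] := IH (e' := e') (S' := S') (D' := D').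
- by move=> k x y xy; apply: e_mono; rewrite ord_mul_ltE /= eqxx xy orbT.
- by move=> k l x y kl; apply: e_mono; rewrite ord_mul_ltE /= a_lt.
- by move=> k; apply: pos_sub (pa k) => x [].
- by move=> k x [Sx Ax]; split=> //; exists (a k, x).
- by apply: no_red_blocks; apply: blocks_sub bl => x [/A'D].
have BD : B `<=` D by apply: subset_trans BV (VD (k := i)).
have D'D : D' `<=` D by move=> x [/A'D].
have D'B : D' `<=` joined c green B by move=> x [[/AB]].
(* The order of the copies places [B] before or after [D']; within one copy, [Z] is all of [B] and
   lies below. *)
apply: no_green_blocks; case: (ltngtP i j) => ij.
- apply: (blocks_front hB BD D'D D'B _ bl).
  by move=> _ _ /BV[x _ <-] [_ [y _ <-]]; apply: e_lt.
- apply: (blocks_back hB BD D'D D'B _ bl).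
  by move=> _ _ /BV[x _ <-] [_ [y _ <-]]; apply: e_lt.
- apply: (blocks_front hB BD D'D D'B _ bl) => x y Bx [[_ yZ] _]; apply: yZ.
  by split=> //; rewrite -(val_inj ij); apply: BV.
Qed.

Lemma step_contradiction : False.
Proof.
pose splits k A := exists B A', [/\ B `<=` A, A' `<=` A, Theta_homogeneous c red B,
  P k A' & A' `<=` joined c red B].
have [[k kP]|nk] := pselect (exists k, forall A, A `<=` V k -> P k A -> splits k A).
  (* Splitting is repeated inside [V k], each time above the last red set. *)
  suff bl m : forall A, A `<=` V k -> P k A -> blocks red m A.
    apply: no_red_blocks; exact: blocks_sub (@VD k) (bl n _ (fun x Vx =>
      Vx) (@P_V k)).
  elim: m => [|m IHm] A AV PA; first exact: blocks0.
  have [B [A' [BA A'A hB PA' A'B]]] := kP A AV PA; have [_ sB _] := hB.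
  have BV : B `<=` V k by apply: subset_trans BA AV.
  have PA'' := P_above sB BV PA'.
  apply: (blocks_front hB BA _ _ _ (IHm _ _ PA'')).
  - by move=> x [/A'A].
  - by move=> x [/A'B].
  - by move=> x y Bx [_]; apply.
  - by move=> x [/A'A/AV].
(* Otherwise every [V k] shrinks to a positive set that does not split, which is the condition on
   red sets in [red_transversal]. *)
have AP k : exists A, [/\ A `<=` V k, P k A & ~ splits k A].
  apply: contrapT => nA; apply: nk; exists k => A AV PA; apply: contrapT => nsp.
  by apply: nA; exists A.
have [A AE] := choice AP.
have AV k : A k `<=` V k by have [] := AE k.
have [|||||||X [XA Xred]] := red_transversal c_sym c_irrefl c_total (V := A) (P := P).
- exact: P_sub.
- exact: P_bigcup.
- exact: P_not_small.
- by move=> k; have [] := AE k.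
- by move=> k B BA; apply: P_green; apply: subset_trans BA (AV k).
- move=> i j B C BA CA; apply: (@no_green i j).
    exact: subset_trans BA (AV i).
  exact: subset_trans CA (AV j).
- move=> i B C BA CA hB PC CB; have [_ _] := AE i; apply.
  by exists B, C.
apply: no_red_blocks.
exists (fun i => if insub i is Some k then X k else set0); split.
- move=> i im; rewrite insubT; have [XAi bX] := XA (Sub i im); split=> //.
  by move=> x /XAi/AV/VD.
- move=> i j x y /andP[ij jn].
  rewrite (insubT (fun k => k < n)%N (ltn_trans ij jn)) (insubT (fun k =>
    k < n)%N jn) => Xx Xy.
  have [s _ <-] := AV _ _ ((XA _).1 _ Xx); have [t _ <-] := AV _ _ ((XA _).1 _ Xy).
  exact: e_lt.
- move=> x y [i im]; rewrite insubT => Xx [j jm]; rewrite insubT => Xy.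
  exact: Xred Xx Xy.
Qed.

End Step.

(** Induction on [r] for arbitrary copies, positive sets and [D], since the step uses rows as the
    copies. For [r = 0] no green block is required. *)
Lemma blocks_or r n (e : 'I_n -> ord_exp Lambda' r -> W) S D :
  (forall k x y, x < y -> e k x < e k y) ->
  (forall (k l : 'I_n) x y, (k < l)%N -> e k x < e l y) ->
  (forall k, pos (S k)) -> (forall k x, S k x -> D (e k x)) ->
  blocks red n D \/ blocks green r D.
Proof.
elim: r e S D => [|r IH] e S D e_mono e_lt S_pos eSD; first by right; exact: blocks0.
apply: contrapT => /not_orP[nred ngreen].
exact: (step_contradiction e_mono e_lt S_pos eSD IH nred ngreen).
Qed.

(** In each block, always take the least point not yet used; fewer than $\theta$ used points never
    exhaust it. *)
Lemma blocks_order_type k m D : blocks k m D ->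
  exists A, [/\ has_order_type A (ord_mul Theta 'I_m), A `<=` D & homogeneous c k A].
Proof.
move=> [X [XD XX hX]].
have fP (i : 'I_m) : exists f : Theta -> W,
    (forall t, X i (f t)) /\ (forall s t, s < t -> f s < f t).
  have [_ bX] := XD i (ltn_ord i); have [w0 _] := big_nonempty bX.
  pose Q (Y : set W) z := ~ Y z /\ forall y, X i y -> ~ Y y -> z <= y.
  have [t Y _ _ Yt|f fP] := @transfinite_choice_set Theta (fun s t => s < t) setT
      W w0 (X i) Q (well_ordered_wf Theta_card.1).
    have [|z [Xz nYz] zmin] := well_ordered_min wo_W (A := X i `\` Y).
      apply: contrapT => nXY; apply: (card_ltK_segment Theta_card (t := t)).
      apply: card_le_trans bX _; apply: (@card_le_trans _ _ _ Y).
        apply: subset_card_le => x Xx; apply: contrapT => nYx.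
        by apply: nXY; exists x.
      by apply: card_le_trans Yt _; apply: subset_card_le => s [].
    by exists z => //; split=> // y Xy nYy; apply: zmin.
  exists f; split=> [t|s t st]; first by have [] := fP t I.
  have [_ [_ smin]] := fP s I; have [Xt [tnew _]] := fP t I.
  rewrite lt_neqAle; apply/andP; split.
    by apply/eqP => fst; apply: tnew; exists s.
  apply: smin => // -[u [_ us] ut]; apply: tnew; exists u => //.
  by split=> //; apply: lt_trans us st.
have [f fE] := choice fP.
pose F (x : ord_mul Theta 'I_m) := f x.1 x.2.
have FX (x : ord_mul Theta 'I_m) : X x.1 (F x) by have [+ _] := fE x.1; apply.
exists (range F); split.
- exists F; split=> //; apply: le_mono => -[i s] [j t]; rewrite ord_mul_ltE /=.
  move=> /orP[ij|/andP[/eqP -> st]]; last by have [_] := fE j; apply.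
  by apply: (XX i j); [rewrite ltn_ord andbT|exact: FX (i, s)|exact: FX (j, t)].
- by move=> _ [x _ <-]; apply: (XD x.1 (ltn_ord _)).1; apply: FX.
- apply: homogeneous_sub hX => _ [x _ <-]; exists (x.1 : nat); first exact: ltn_ord.
  exact: FX.
Qed.

End Blocks.

End CardinalArithmetic.

(** * From colourings of pairs to graphs *)

Lemma well_ordered_exp d (A : orderType d) r : well_ordered A ->
  well_ordered (ord_exp A r).
Proof.
move=> woA; elim: r => [|r IH] /=; first exact: well_ordered_ord.
exact: well_ordered_mul.
Qed.

(** Quantifying over [e] spares building the two-element subset inside the definition. For equal
    points that clause would hold vacuously, so [x <> y] excludes loops. *)
Definition edge (T : choiceType) (c : pairs T ->
  color) (k : color) (x y : T) : Prop :=
  x <> y /\ forall e : pairs T, val e = [fset x; y]%fset -> c e = k.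

Lemma edge_sym (T : choiceType) (c : pairs T -> color) k x y :
  edge c k x y -> edge c k y x.
Proof. by move=> [xy cxy]; split=> [/esym//|e]; rewrite fsetUC => /cxy. Qed.

Lemma edge_irrefl (T : choiceType) (c : pairs T -> color) k x : ~ edge c k x x.
Proof. by case. Qed.

Lemma edge_total (T : choiceType) (c : pairs T -> color) x y :
  x <> y -> edge c red x y \/ edge c green x y.
Proof.
move=> xy; have e2 : #|` [fset x; y]%fset| == 2%N.
  by rewrite cardfs2; move/eqP: xy => ->.
pose e : pairs T := Sub [fset x; y]%fset e2.
have eE (e' : pairs T) : val e' = [fset x; y]%fset -> e' = e by move=> ?;
  apply: val_inj.
by case ce: (c e); [left|right]; split=> // e' /eE ->; rewrite ce.
Qed.

Lemma edge_constant (T : choiceType) (c : pairs T -> color) k (A : set T) :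
  homogeneous (edge c) k A -> constant_on c k A.
Proof.
move=> hA [e e2] eA; have /fset0Pn[x xe] : e != fset0 by rewrite -cardfs_gt0 (eqP e2).
have /cardfs1P[y ey] : #|` (e `\ x)%fset| == 1%N.
  by have := e2; rewrite (cardfsD1 x) xe.
have /fsetD1P[yx ye] : y \in (e `\ x)%fset by rewrite ey in_fset1.
have [|_] := hA x y (eA x xe) (eA y ye); first by move=> xy; rewrite xy eqxx in yx.
by apply; rewrite /= -ey fsetD1K.
Qed.

(* Lambda' is the successor cardinal of Lambda; the finite ordinals n and r are
   the ordered types 'I_n and 'I_r. *)
Theorem claim4
    (dT : Order.disp_t) (Theta : orderType dT)
    (dL : Order.disp_t) (Lambda : orderType dL)
    (dL' : Order.disp_t) (Lambda' : orderType dL')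
    (n r : nat)
    (Theta_card : is_cardinal Theta)
    (Theta_gt_aleph0 : card_lt [set: nat] [set: Theta])
    (Lambda_card : is_cardinal Lambda)
    (Lambda_infinite : infinite_set [set: Lambda])
    (Lambda_power : is_power_below Lambda Theta Lambda)
    (Lambda'_succ : is_succ_cardinal Lambda Lambda') :
  arrows (ord_mul (ord_exp Lambda' r) 'I_n)
         (ord_mul Theta 'I_n) (ord_mul Theta 'I_r).
Proof.
case: Lambda_power => _ Lambda_bound _ c.
have [Lambda'_card _ _] := Lambda'_succ.
pose W := ord_mul (ord_exp Lambda' r) 'I_n.
have wo_W : well_ordered W.
  apply: well_ordered_mul; last exact: well_ordered_ord.
  by apply: well_ordered_exp; case: Lambda'_card.
pose e (k : 'I_n) (x : ord_exp Lambda' r) : W := (k, x).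
have order_type k m : blocks Theta (edge c) k m setT ->
    exists A, has_order_type A (ord_mul Theta 'I_m) /\ constant_on c k A.
  move=> /(blocks_order_type Theta_card Theta_gt_aleph0 wo_W).
  by move=> [A [tA _ hA]]; exists A; split=> //; apply: edge_constant.
have [|||//|bl|bl] := @blocks_or _ Theta _ Lambda _ Lambda' Theta_card Theta_gt_aleph0
  Lambda_card Lambda_infinite Lambda_bound Lambda'_succ _ W wo_W (edge c)
  (@edge_sym _ c) (@edge_irrefl _ c) (@edge_total _ c) r n e (fun=> setT) setT.
- by move=> k x y xy; rewrite ord_mul_ltE /= eqxx xy orbT.
- by move=> k l x y kl; rewrite ord_mul_ltE /= ltEord kl.
- by move=> k; apply: pos_setT.
- by left; apply: order_type.
- by right; apply: order_type.
Qed.
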